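(* Let $(\mathcal A_n)_{n\in\mathbb N}$ be a sequence of Banach algebras and let $\mathcal U$ be a non-principal ultrafilter on $\mathbb N$. Assume that, whenever one of the algebras $\mathcal A_n$, or the ultraproduct $(\mathcal A_n)_{\mathcal U}$, has a multiplicative identity, this identity has norm $1$. Then $(\mathcal A_n)_{\mathcal U}$ is unital if and only if there is $U\in\mathcal U$ such that $\mathcal A_n$ is unital for each $n\in U$.
   Context: Banach algebras are complex, not necessarily unital, and have a contractive product $\|ab\|\le\|a\|\|b\|$. ''Unital'' means possessing a (two-sided) multiplicative identity. For a sequence $(\mathcal A_n)$ of Banach algebras, $\ell^\infty(\mathcal A_n)$ is the Banach algebra of all bounded sequences $(a_n)$ with $a_n\in\mathcal A_n$, with pointwise operations and the supremum norm; $c_{\mathcal U}(\mathcal A_n)$ is the closed two-sided ideal of those $(a_n)$ with $\lim_{n\to\mathcal U}\|a_n\|=0$; the ultraproduct is $(\mathcal A_n)_{\mathcal U}=\ell^\infty(\mathcal A_n)/c_{\mathcal U}(\mathcal A_n)$ with the quotient norm, so the class of $(a_n)$ has norm $\lim_{n\to\mathcal U}\|a_n\|$. *)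

(* Defs.v *)
From HB Require Import structures.
From mathcomp Require Import all_boot all_order all_algebra.
From mathcomp Require Import all_classical all_reals all_analysis.
From mathcomp Require Import ring_quotient complex ring.

Set Implicit Arguments.
Unset Strict Implicit.
Unset Printing Implicit Defensive.

Import Order.TTheory GRing.Theory Num.Theory.
Import numFieldNormedType.Exports.

Local Open Scope classical_set_scope.
Local Open Scope complex_scope.
Local Open Scope ring_scope.

(* Not built on the ring structures of MathComp, which all have a unit. *)
HB.mixin Record CompleteNormedModule_isBanachAlgebra (K : numFieldType) A
    & CompleteNormedModule K A := {
  bmul : A -> A -> A;
  bmulA : associative bmul;
  bmulDl : left_distributive bmul +%R;
  bmulDr : right_distributive bmul +%R;
  bscalerAl : forall (k : K) a b, k *: bmul a b = bmul (k *: a) b;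
  bscalerAr : forall (k : K) a b, k *: bmul a b = bmul a (k *: b);
  ler_bnormM : forall a b, `|bmul a b| <= `|a| * `|b|
}.

#[short(type="banachAlgType")]
HB.structure Definition BanachAlgebra (K : numFieldType) :=
  {A of CompleteNormedModule K A & CompleteNormedModule_isBanachAlgebra K A}.

Notation "a ** b" := (bmul a b) (at level 40, left associativity) : ring_scope.

Section banach_algebra_theory.
Context {K : numFieldType} {B : banachAlgType K}.
Implicit Types a b : B.

(* In the zero algebra 0 is an identity, of norm 0. *)
Definition is_identity (e : B) := forall a, e ** a = a /\ a ** e = a.

Definition unital := exists e : B, is_identity e.

Lemma bmul0r a : 0 ** a = 0.
Proof. by apply: (addrI (0 ** a)); rewrite -bmulDl !addr0. Qed.

Lemma bmulr0 a : a ** 0 = 0.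
Proof. by apply: (addrI (a ** 0)); rewrite -bmulDr !addr0. Qed.

Lemma bmulNr a b : (- a) ** b = - (a ** b).
Proof. by rewrite -[- a]scaleN1r -bscalerAl scaleN1r. Qed.

Lemma bmulrN a b : a ** (- b) = - (a ** b).
Proof. by rewrite -[- b]scaleN1r -bscalerAr scaleN1r. Qed.

Lemma bmulBl a b c : (a - b) ** c = a ** c - b ** c.
Proof. by rewrite bmulDl bmulNr. Qed.

Lemma bmulBr a b c : a ** (b - c) = a ** b - a ** c.
Proof. by rewrite bmulDr bmulrN. Qed.

End banach_algebra_theory.
Arguments unital {K} B.

(* The norm of a complex normed module is a complex number, namely a
   nonnegative real one; rnorm is the same norm as an element of R. *)
Section real_norm.
Context {R : realType}.

Definition rnorm {V : normedZmodType R[i]} (x : V) : R := complex.Re `|x|.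

Lemma rnormE {V : normedZmodType R[i]} (x : V) : `|x| = (rnorm x)%:C.
Proof. by rewrite /rnorm RRe_real// normr_real. Qed.

Lemma rnorm_ge0 {V : normedZmodType R[i]} (x : V) : 0 <= rnorm x.
Proof. rewrite -(@lecR R) -rnormE; exact: normr_ge0. Qed.

Lemma ler_rnormP {V W : normedZmodType R[i]} (x : V) (y : W) :
  (`|x| <= `|y|) = (rnorm x <= rnorm y).
Proof. by rewrite !rnormE lecR. Qed.

Lemma gt0_realC (e : R[i]) : 0 < e -> exists2 r : R, 0 < r & e = r%:C.
Proof.
move=> e0; exists (complex.Re e); last by rewrite RRe_real// gtr0_real.
by rewrite -(@ltcR R) RRe_real// gtr0_real.
Qed.

Lemma ge0_realC (e : R[i]) : 0 <= e -> exists2 r : R, 0 <= r & e = r%:C.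
Proof.
move=> e0; exists (complex.Re e); last by rewrite RRe_real// ger0_real.
by rewrite -(@lecR R) RRe_real// ger0_real.
Qed.

Lemma half_expr_lt (e : R[i]) : 0 < e -> exists k, 2%:R^-1 ^+ k < e.
Proof.
move=> /gt0_realC[r r0 ->].
have h1 : `|2%:R^-1 : R| < 1 by rewrite ger0_norm ?invr_ge0// invf_lt1 ?ltr1n.
have /cvgrPdist_lt/(_ r r0) := cvg_expr h1.
move=> /filter_ex[k]; rewrite sub0r normrN ger0_norm ?exprn_ge0 ?invr_ge0//.
by move=> kr; exists k; rewrite -(rmorph_nat (real_complex R)) -fmorphV -rmorphXn ltcR.
Qed.

Lemma rnormD {V : normedZmodType R[i]} (x y : V) :
  rnorm (x + y) <= rnorm x + rnorm y.
Proof. by rewrite -(@lecR R) rmorphD/= -!rnormE ler_normD. Qed.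

Lemma rnormM {A : banachAlgType R[i]} (a b : A) :
  rnorm (a ** b) <= rnorm a * rnorm b.
Proof. by rewrite -(@lecR R) rmorphM/= -!rnormE ler_bnormM. Qed.

End real_norm.

Section bounded_sequences.
Context {R : realType}.
Variable A : nat -> banachAlgType R[i].

Record linfty := Linfty {
  linfty_seq :> forall n, A n;
  linfty_bounded : exists M : R[i], forall n, `|linfty_seq n| <= M }.

Implicit Types a b : linfty.

Lemma linftyP a b : (forall n, a n = b n) -> a = b.
Proof.
case: a b => [a ba] [b bb] /= ab.
have {}ab : a = b by exact: functional_extensionality_dep.
by rewrite ab in ba *; congr Linfty; exact: Prop_irrelevance.
Qed.

HB.instance Definition _ := gen_eqMixin linfty.
HB.instance Definition _ := gen_choiceMixin linfty.

Fact linfty_zero_subproof : exists M : R[i], forall n, `|0 : A n| <= M.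
Proof. by exists 0 => n; rewrite normr0. Qed.

Fact linfty_opp_subproof a : exists M : R[i], forall n, `|- a n| <= M.
Proof. by have [M aM] := linfty_bounded a; exists M => n; rewrite normrN. Qed.

Fact linfty_add_subproof a b : exists M : R[i], forall n, `|a n + b n| <= M.
Proof.
have [M aM] := linfty_bounded a; have [N bN] := linfty_bounded b.
by exists (M + N) => n; apply: le_trans (ler_normD _ _) _; apply: lerD.
Qed.

Fact linfty_scale_subproof (k : R[i]) a :
  exists M : R[i], forall n, `|k *: a n| <= M.
Proof.
have [M aM] := linfty_bounded a.
by exists (`|k| * M) => n; rewrite normrZ ler_wpM2l//; exact: aM.
Qed.

Fact linfty_mul_subproof a b : exists M : R[i], forall n, `|a n ** b n| <= M.
Proof.
have [M aM] := linfty_bounded a; have [N bN] := linfty_bounded b.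
exists (M * N) => n; apply: le_trans (ler_bnormM _ _) _.
by apply: ler_pM => //; [exact: aM|exact: bN].
Qed.

Definition linfty_zero := Linfty linfty_zero_subproof.
Definition linfty_opp a := Linfty (linfty_opp_subproof a).
Definition linfty_add a b := Linfty (linfty_add_subproof a b).
Definition linfty_scale k a := Linfty (linfty_scale_subproof k a).
Definition linfty_mul a b := Linfty (linfty_mul_subproof a b).

Fact linfty_addA : associative linfty_add.
Proof. by move=> a b c; apply: linftyP => n /=; rewrite addrA. Qed.
Fact linfty_addC : commutative linfty_add.
Proof. by move=> a b; apply: linftyP => n /=; rewrite addrC. Qed.
Fact linfty_add0 : left_id linfty_zero linfty_add.
Proof. by move=> a; apply: linftyP => n /=; rewrite add0r. Qed.
Fact linfty_addN : left_inverse linfty_zero linfty_opp linfty_add.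
Proof. by move=> a; apply: linftyP => n /=; rewrite addNr. Qed.

HB.instance Definition _ := GRing.isZmodule.Build linfty
  linfty_addA linfty_addC linfty_add0 linfty_addN.

Fact linfty_scaleA k l a :
  linfty_scale k (linfty_scale l a) = linfty_scale (k * l) a.
Proof. by apply: linftyP => n /=; rewrite scalerA. Qed.
Fact linfty_scale1 : left_id 1 linfty_scale.
Proof. by move=> a; apply: linftyP => n /=; rewrite scale1r. Qed.
Fact linfty_scaleDr : right_distributive linfty_scale +%R.
Proof. by move=> k a b; apply: linftyP => n /=; rewrite scalerDr. Qed.
Fact linfty_scaleDl a : {morph linfty_scale^~ a : k l / k + l}.
Proof. by move=> k l; apply: linftyP => n /=; rewrite scalerDl. Qed.

HB.instance Definition _ := GRing.Zmodule_isLmodule.Build R[i] linfty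
  linfty_scaleA linfty_scale1 linfty_scaleDr linfty_scaleDl.

Definition linfty_norm a : R[i] := (sup (range (fun n => rnorm (a n))))%:C.

Lemma linfty_has_sup a : has_sup (range (fun n => rnorm (a n))).
Proof.
split; first by exists (rnorm (a 0%N)), 0%N.
have [M aM] := linfty_bounded a; have M0 : 0 <= M by exact: le_trans (aM 0%N).
have [r _ Mr] := ge0_realC M0.
by exists r => _ [n _ <-]; rewrite -(@lecR R) -Mr -rnormE; exact: aM.
Qed.

Lemma ler_linfty_norm a n : `|a n| <= linfty_norm a.
Proof.
rewrite rnormE lecR; apply: sup_upper_bound; first exact: linfty_has_sup.
by exists n.
Qed.

Lemma linfty_norm_le a (M : R[i]) :
  (forall n, `|a n| <= M) -> linfty_norm a <= M.
Proof.
move=> aM; have M0 : 0 <= M by exact: le_trans (aM 0%N).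
have [r _ Mr] := ge0_realC M0; rewrite Mr lecR.
apply: ge_sup; first by exists (rnorm (a 0%N)), 0%N.
by move=> _ [n _ <-]; rewrite -(@lecR R) -Mr -rnormE; exact: aM.
Qed.

Lemma linfty_norm_ge0 a : 0 <= linfty_norm a.
Proof. exact: le_trans (ler_linfty_norm a 0%N). Qed.

Fact linfty_normD a b : linfty_norm (a + b) <= linfty_norm a + linfty_norm b.
Proof.
apply: linfty_norm_le => n; apply: le_trans (ler_normD _ _) _.
by rewrite lerD// ler_linfty_norm.
Qed.

Fact linfty_normZ k a : linfty_norm (k *: a) = `|k| * linfty_norm a.
Proof.
have le_normZ l b : linfty_norm (l *: b) <= `|l| * linfty_norm b.
  by apply: linfty_norm_le => n; rewrite normrZ ler_wpM2l// ler_linfty_norm.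
apply/eqP; rewrite eq_le le_normZ/=.
have [->|k0] := eqVneq k 0; first by rewrite normr0 mul0r linfty_norm_ge0.
rewrite -ler_pdivlMl ?normr_gt0// -normfV.
by apply: le_trans (le_normZ _ _); rewrite scalerA mulVf// scale1r.
Qed.

Fact linfty_norm0_eq0 a : linfty_norm a = 0 -> a = 0.
Proof.
move=> a0; apply: linftyP => n; apply/eqP.
by rewrite -normr_le0 -a0 ler_linfty_norm.
Qed.

HB.instance Definition _ := Lmodule_isNormed.Build R[i] linfty
  linfty_normD linfty_normZ linfty_norm0_eq0.

Fact linfty_complete (F : set_system linfty) :
  ProperFilter F -> cauchy F -> cvg F.
Proof.
move=> FF Fc.
have Fn n : cvg ((fun x : linfty => x n) @ F).
  apply: cauchy_cvg; apply/cauchy_exP => e e0.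
  have /cauchyP/(_ e e0) [x Fx] := Fc.
  exists (x n); change (F [set y : linfty | ball (x n) e (y n)]).
  apply: filterS Fx => y; rewrite /= -!ball_normE /=.
  by apply: le_lt_trans; exact: (ler_linfty_norm (x - y) n).
pose l n := lim ((fun x : linfty => x n) @ F).
have near_l (e : R[i]) : 0 < e ->
    exists2 x, F (ball x e) & forall n, `|x n - l n| <= e + e.
  move=> e0; have /cauchyP/(_ e e0) [x Fx] := Fc; exists x => // n.
  have /cvgrPdist_lt/(_ e e0) Fl := Fn n.
  have [y [+ yl]] := filter_ex (filterI Fx Fl).
  rewrite -ball_normE/= => xy; rewrite -(subrKA (y n)).
  apply: le_trans (ler_normD _ _) _; apply: lerD.
    by apply: le_trans (ltW xy); exact: (ler_linfty_norm (x - y) n).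
  by rewrite distrC; exact: ltW.
have l_bounded : exists M : R[i], forall n, `|l n| <= M.
  have [x _ xl] := near_l _ ltr01.
  exists (`|x| + (1 + 1)) => n; rewrite -[l n](subrK (x n)) addrC.
  apply: le_trans (ler_normD _ _) _; apply: lerD; first exact: ler_linfty_norm.
  by rewrite distrC; exact: xl.
apply/cvg_ex; exists (Linfty l_bounded); apply/cvgrPdist_le => e e0.
have e3 : 0 < e / 3%:R by rewrite divr_gt0.
have [x Fx xl] := near_l _ e3.
apply: filterS Fx => y; rewrite -ball_normE/= => xy.
apply: linfty_norm_le => n; rewrite -/(Linfty l_bounded n - y n)/=.
rewrite -(subrKA (x n)) [X in _ <= X](_ : _ = (e / 3%:R + e / 3%:R) + e / 3%:R).
  apply: le_trans (ler_normD _ _) _; apply: lerD; first by rewrite distrC.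
  by apply: le_trans (ltW xy); exact: (ler_linfty_norm (x - y) n).
by field.
Qed.

HB.instance Definition _ := Uniform_isComplete.Build linfty linfty_complete.

Fact linfty_mulA : associative linfty_mul.
Proof. by move=> a b c; apply: linftyP => n /=; rewrite bmulA. Qed.
Fact linfty_mulDl : left_distributive linfty_mul +%R.
Proof. by move=> a b c; apply: linftyP => n /=; rewrite bmulDl. Qed.
Fact linfty_mulDr : right_distributive linfty_mul +%R.
Proof. by move=> a b c; apply: linftyP => n /=; rewrite bmulDr. Qed.
Fact linfty_scaleAl k a b : k *: linfty_mul a b = linfty_mul (k *: a) b.
Proof. by apply: linftyP => n /=; rewrite bscalerAl. Qed.
Fact linfty_scaleAr k a b : k *: linfty_mul a b = linfty_mul a (k *: b).
Proof. by apply: linftyP => n /=; rewrite bscalerAr. Qed.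
Fact linfty_normM a b : `|linfty_mul a b| <= `|a| * `|b|.
Proof.
apply: linfty_norm_le => n; apply: le_trans (ler_bnormM _ _) _.
by rewrite ler_pM// ler_linfty_norm.
Qed.

HB.instance Definition _ := CompleteNormedModule_isBanachAlgebra.Build R[i]
  linfty linfty_mulA linfty_mulDl linfty_mulDr linfty_scaleAl linfty_scaleAr
  linfty_normM.

Lemma rnorm_linfty a n : rnorm (a n) <= rnorm a.
Proof. by rewrite -ler_rnormP; exact: ler_linfty_norm. Qed.

End bounded_sequences.

Section quotient_algebra.
Context {R : realType}.

Record closed_ideal (B : banachAlgType R[i]) := ClosedIdeal {
  ideal_set :> B -> Prop;
  ideal0 : ideal_set 0;
  idealD : forall a b, ideal_set a -> ideal_set b -> ideal_set (a + b);
  idealZ : forall (k : R[i]) a, ideal_set a -> ideal_set (k *: a);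
  ideal_mull : forall a b, ideal_set b -> ideal_set (a ** b);
  ideal_mulr : forall a b, ideal_set a -> ideal_set (a ** b);
  ideal_closed : closed [set a | ideal_set a] }.

Context {B : banachAlgType R[i]}.
Variable I : closed_ideal B.
Implicit Types a b : B.

Definition ideal_pred : {pred B} := fun a => `[< I a >].

Fact ideal_zmod_closed : zmod_closed ideal_pred.
Proof.
split; first by apply/asboolP; exact: ideal0.
move=> a b /asboolP Ia /asboolP Ib; apply/asboolP.
by apply: idealD => //; rewrite -scaleN1r; exact: idealZ.
Qed.

HB.instance Definition _ := GRing.isZmodClosed.Build B ideal_pred
  ideal_zmod_closed.

Definition bquot := @Quotient.quot B ideal_pred.

HB.instance Definition _ := GRing.Zmodule.on bquot.
HB.instance Definition _ := Quotient.on bquot.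

Definition bproj (a : B) : bquot := \pi_bquot%qT a.

Lemma bproj_eqP a b : bproj a = bproj b <-> I (a - b).
Proof.
split=> [|Iab]; last first.
  by apply/eqP; rewrite -Quotient.idealrBE; apply/asboolP.
by move/eqP; rewrite -Quotient.idealrBE => /asboolP.
Qed.

Lemma bprojD a b : bproj (a + b) = bproj a + bproj b.
Proof. exact: Quotient.pi_add. Qed.

Lemma bproj0 : bproj 0 = 0.
Proof. by apply: (addrI (bproj 0)); rewrite -bprojD !addr0. Qed.

Lemma bprojN a : bproj (- a) = - bproj a.
Proof. by apply: (addrI (bproj a)); rewrite -bprojD !subrr bproj0. Qed.

Lemma bprojB a b : bproj (a - b) = bproj a - bproj b.
Proof. by rewrite bprojD bprojN. Qed.

Lemma bproj_repr (q : bquot) : bproj (repr q) = q.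
Proof. exact: reprK. Qed.

Lemma bproj_surj (q : bquot) : exists a, q = bproj a.
Proof. by exists (repr q); rewrite bproj_repr. Qed.

Definition bquot_scale (k : R[i]) (q : bquot) : bquot := bproj (k *: repr q).

Definition bquot_mul (p q : bquot) : bquot := bproj (repr p ** repr q).

Lemma bproj_scale k a : bquot_scale k (bproj a) = bproj (k *: a).
Proof.
apply/bproj_eqP; rewrite -scalerBr; apply: idealZ.
by apply/bproj_eqP; rewrite bproj_repr.
Qed.

Lemma bproj_mul a b : bquot_mul (bproj a) (bproj b) = bproj (a ** b).
Proof.
have IB c : I (repr (bproj c) - c) by apply/bproj_eqP; rewrite bproj_repr.
apply/bproj_eqP; rewrite -(subrKA (a ** repr (bproj b))) -bmulBl -bmulBr.
by apply: idealD; [exact: ideal_mulr|exact: ideal_mull].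
Qed.

Fact bquot_scaleA k l q :
  bquot_scale k (bquot_scale l q) = bquot_scale (k * l) q.
Proof. by have [a ->] := bproj_surj q; rewrite !bproj_scale scalerA. Qed.
Fact bquot_scale1 : left_id 1 bquot_scale.
Proof. by move=> q; have [a ->] := bproj_surj q; rewrite bproj_scale scale1r. Qed.
Fact bquot_scaleDr : right_distributive bquot_scale +%R.
Proof.
move=> k p q; have [a ->] := bproj_surj p; have [b ->] := bproj_surj q.
by rewrite -bprojD !bproj_scale -bprojD scalerDr.
Qed.
Fact bquot_scaleDl q : {morph bquot_scale^~ q : k l / k + l}.
Proof.
move=> k l; have [a ->] := bproj_surj q.
by rewrite !bproj_scale -bprojD scalerDl.
Qed.

HB.instance Definition _ := GRing.Zmodule_isLmodule.Build R[i] bquot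
  bquot_scaleA bquot_scale1 bquot_scaleDr bquot_scaleDl.

Lemma bprojZ k a : bproj (k *: a) = k *: bproj a.
Proof. by rewrite -bproj_scale. Qed.

Definition bquot_norm (q : bquot) : R[i] :=
  (inf [set rnorm a | a in [set a | bproj a = q]])%:C.

Lemma bquot_norm_lbound q :
  has_lbound [set rnorm a | a in [set a | bproj a = q]].
Proof. by exists 0 => _ [a _ <-]; exact: rnorm_ge0. Qed.

Lemma bquot_norm_le a : bquot_norm (bproj a) <= `|a|.
Proof.
rewrite rnormE lecR; apply: ge_inf; first exact: bquot_norm_lbound.
by exists a.
Qed.

Lemma bquot_norm_ge0 q : 0 <= bquot_norm q.
Proof.
rewrite (_ : 0 = (0 : R)%:C)// lecR; apply: lb_le_inf.
  by exists (rnorm (repr q)), (repr q) => //; exact: bproj_repr.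
by move=> _ [a _ <-]; exact: rnorm_ge0.
Qed.

Lemma bquot_norm_lt q (e : R[i]) :
  bquot_norm q < e -> exists2 a, bproj a = q & `|a| < e.
Proof.
move=> qe.
have [r r0 er] := gt0_realC (le_lt_trans (bquot_norm_ge0 q) qe).
move: qe; rewrite er ltcR => /inf_lt[|_ [a aq <-] ar].
  by exists (rnorm (repr q)), (repr q) => //; exact: bproj_repr.
by exists a => //; rewrite rnormE ltcR.
Qed.

Lemma bquot_norm_adherent q (e : R[i]) :
  0 < e -> exists2 a, bproj a = q & `|a| < bquot_norm q + e.
Proof. by move=> e0; apply: bquot_norm_lt; rewrite ltrDl. Qed.

Fact bquot_normD p q : bquot_norm (p + q) <= bquot_norm p + bquot_norm q.
Proof.
apply/ler_addgt0Pr => e e0; have e2 : 0 < e / 2%:R by rewrite divr_gt0.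
have [a ap ae] := bquot_norm_adherent p e2.
have [b bq be] := bquot_norm_adherent q e2.
rewrite -{1}ap -{1}bq -bprojD; apply: le_trans (bquot_norm_le _) _.
apply: le_trans (ler_normD _ _) _.
apply: le_trans (lerD (ltW ae) (ltW be)) _.
by rewrite addrACA -splitr.
Qed.

Fact bquot_normZ k q : bquot_norm (k *: q) = `|k| * bquot_norm q.
Proof.
have le_normZ l p : bquot_norm (l *: p) <= `|l| * bquot_norm p.
  have [->|l0] := eqVneq l 0.
    by rewrite scale0r normr0 mul0r -bproj0 -[leRHS](@normr0 _ B) bquot_norm_le.
  have l_gt0 : 0 < `|l| by rewrite normr_gt0.
  apply/ler_addgt0Pr => e e0; have el : 0 < e / `|l| by rewrite divr_gt0.
  have [a <- ae] := bquot_norm_adherent p el.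
  rewrite -bprojZ; apply: le_trans (bquot_norm_le _) _; rewrite normrZ.
  apply: le_trans (ler_wpM2l (ltW l_gt0) (ltW ae)) _.
  by rewrite mulrDr mulrCA divff ?mulr1// gt_eqF.
apply/eqP; rewrite eq_le le_normZ/=.
have [->|k0] := eqVneq k 0; first by rewrite normr0 mul0r bquot_norm_ge0.
rewrite -ler_pdivlMl ?normr_gt0// -normfV.
by apply: le_trans (le_normZ _ _); rewrite scalerA mulVf// scale1r.
Qed.

Fact bquot_norm0_eq0 q : bquot_norm q = 0 -> q = 0.
Proof.
have [a ->] := bproj_surj q => a0; rewrite -bproj0; apply/bproj_eqP.
rewrite subr0; apply: (@ideal_closed _ I) => V /nbhs_ballP[e /= e0 eV].
have [|b ba be] := @bquot_norm_lt (bproj a) e; first by rewrite a0.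
exists (a - b); split; first exact/bproj_eqP.
by apply: eV; rewrite -ball_normE/= subKr.
Qed.

HB.instance Definition _ := Lmodule_isNormed.Build R[i] bquot
  bquot_normD bquot_normZ bquot_norm0_eq0.

Fact bquot_complete (F : set_system bquot) :
  ProperFilter F -> cauchy F -> cvg F.
Proof.
move=> FF Fc; pose h : R[i] := 2%:R^-1.
have h_gt0 k : 0 < h ^+ k by rewrite exprn_gt0// invr_gt0.
have hS k : h ^+ k = h ^+ k.+1 + h ^+ k.+1.
  have hh : h + h = 1 by rewrite /h; field.
  by rewrite exprSr -mulrDr hh mulr1.
have /choice[x Fx] : forall k, exists x, F (ball x (h ^+ k)).
  by move=> k; have /cauchyP/(_ _ (h_gt0 k))[x Fx] := Fc; exists x.
have /choice[d dP] : forall k, exists d : B,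
    bproj d = x k.+1 - x k /\ `|d| < h ^+ k + h ^+ k.
  move=> k; have [y []] := filter_ex (filterI (Fx k) (Fx k.+1)).
  rewrite -!ball_normE/= => yk yk1.
  have [|a ap ae] := @bquot_norm_lt (x k.+1 - x k) (h ^+ k + h ^+ k).
    rewrite -(subrKA y); apply: le_lt_trans (bquot_normD _ _) _.
    have := ltrD yk1 yk; rewrite [X in _ + X < _]distrC => /lt_le_trans; apply.
    by rewrite lerD2r [leRHS]hS lerDl ltW.
  by exists a.
pose b k := repr (x 0%N) + \sum_(i < k) d i.
have bS k : b k.+1 = b k + d k by rewrite /b big_ord_recr/= addrA.
have bx k : bproj (b k) = x k.
  elim: k => [|k IHk]; first by rewrite /b big_ord0 addr0 bproj_repr.
  by rewrite bS bprojD IHk (dP k).1 addrC subrK.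
have b_dist k m : `|b k - b (k + m)%N| <= h ^+ k *+ 4 - h ^+ (k + m) *+ 4.
  elim: m => [|m IHm]; first by rewrite addn0 !subrr normr0.
  rewrite addnS bS opprD addrA; apply: le_trans (ler_normB _ _) _.
  apply: le_trans (lerD IHm (ltW (dP _).2)) _.
  rewrite (hS (k + m)%N); set u := h ^+ k; set v := h ^+ _.
  by rewrite le_eqVlt; apply/orP; left; apply/eqP; ring.
have b_dist4 k n : (k <= n)%N -> `|b k - b n| <= h ^+ k *+ 4.
  move=> /subnKC <-; apply: le_trans (b_dist _ _) _.
  by rewrite gerBl mulrn_wge0// ltW.
have b_cvg : cvg (b @ \oo).
  apply: cauchy_cvg; apply/cauchy_exP => e e0.
  have [k ke] := half_expr_lt (divr_gt0 e0 (ltr0Sn _ 3)).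
  exists (b k); exists k => // n /= kn; rewrite -ball_normE/=.
  apply: le_lt_trans (b_dist4 _ _ kn) _.
  by rewrite -mulr_natr -ltr_pdivlMr.
pose l := lim (b @ \oo).
have bl k : `|l - b k| <= h ^+ k *+ 5.
  have /cvgrPdist_le/(_ _ (h_gt0 k)) lb := b_cvg.
  have [n [kn ln]] := filter_ex (filterI (nbhs_infty_ge k) lb).
  rewrite -(subrKA (b n)); apply: le_trans (ler_normD _ _) _.
  by rewrite mulrS lerD// distrC b_dist4.
apply/cvg_ex; exists (bproj l); apply/cvgrPdist_le => e e0.
have [k ke] := half_expr_lt (divr_gt0 e0 (ltr0Sn _ 5)).
apply: filterS (Fx k) => y; rewrite -ball_normE/= => xy.
rewrite -(subrKA (x k)); apply: le_trans (ler_normD _ _) _.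
have : bquot_norm (bproj l - x k) <= h ^+ k *+ 5.
  by rewrite -bx -bprojB; apply: le_trans (bquot_norm_le _) (bl k).
move=> /lerD/(_ (ltW xy))/le_trans; apply.
by rewrite -mulrSr -mulr_natr -ler_pdivlMr// ltW.
Qed.

HB.instance Definition _ := Uniform_isComplete.Build bquot bquot_complete.

Fact bquot_mulA : associative bquot_mul.
Proof.
move=> p q r; have [a ->] := bproj_surj p; have [b ->] := bproj_surj q.
by have [c ->] := bproj_surj r; rewrite !bproj_mul bmulA.
Qed.
Fact bquot_mulDl : left_distributive bquot_mul +%R.
Proof.
move=> p q r; have [a ->] := bproj_surj p; have [b ->] := bproj_surj q.
by have [c ->] := bproj_surj r; rewrite -bprojD !bproj_mul -bprojD bmulDl.
Qed.
Fact bquot_mulDr : right_distributive bquot_mul +%R.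
Proof.
move=> p q r; have [a ->] := bproj_surj p; have [b ->] := bproj_surj q.
by have [c ->] := bproj_surj r; rewrite -bprojD !bproj_mul -bprojD bmulDr.
Qed.
Fact bquot_scaleAl k p q : k *: bquot_mul p q = bquot_mul (k *: p) q.
Proof.
have [a ->] := bproj_surj p; have [b ->] := bproj_surj q.
rewrite -[LHS]/(bquot_scale _ _) -[k *: bproj a]/(bquot_scale _ _).
by rewrite bproj_mul !bproj_scale bproj_mul bscalerAl.
Qed.
Fact bquot_scaleAr k p q : k *: bquot_mul p q = bquot_mul p (k *: q).
Proof.
have [a ->] := bproj_surj p; have [b ->] := bproj_surj q.
rewrite -[LHS]/(bquot_scale _ _) -[k *: bproj b]/(bquot_scale _ _).
by rewrite bproj_mul !bproj_scale bproj_mul bscalerAr.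
Qed.
Fact bquot_normM p q : `|bquot_mul p q| <= `|p| * `|q|.
Proof.
rewrite -[leRHS]/(bquot_norm p * bquot_norm q).
have := bquot_norm_ge0 p; have := bquot_norm_ge0 q.
have := bquot_norm_adherent p; have := bquot_norm_adherent q.
move: (bquot_norm p) (bquot_norm q) => u v qv pu v0 u0.
apply/ler_addgt0Pr => e e0; pose s := u + v + 1 + e.
have s_gt0 : 0 < s by rewrite addr_gt0// ltr_wpDl// addr_ge0.
pose d := e / s; have d_gt0 : 0 < d by rewrite divr_gt0.
have d_le1 : d <= 1.
  by rewrite ler_pdivrMr// mul1r lerDr !addr_ge0.
have [a ap ad] := pu _ d_gt0; have [b bq bd] := qv _ d_gt0.
rewrite -ap -bq bproj_mul; apply: le_trans (bquot_norm_le _) _.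
apply: le_trans (ler_bnormM _ _) _.
apply: le_trans (ler_pM (normr_ge0 _) (normr_ge0 _) (ltW ad) (ltW bd)) _.
have -> : (u + d) * (v + d) = u * v + d * (u + v + d) by ring.
rewrite lerD2l (_ : e = d * s); last by rewrite /d divfK// gt_eqF.
rewrite ler_wpM2l ?(ltW d_gt0)// /s -[_ + 1 + e]addrA lerD2l.
by rewrite (le_trans d_le1)// lerDl ltW.
Qed.

HB.instance Definition _ := CompleteNormedModule_isBanachAlgebra.Build R[i]
  bquot bquot_mulA bquot_mulDl bquot_mulDr bquot_scaleAl bquot_scaleAr
  bquot_normM.

Lemma bprojM a b : bproj (a ** b) = bproj a ** bproj b.
Proof. by rewrite -bproj_mul. Qed.

End quotient_algebra.

Section ultraproduct.
Context {R : realType}.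
Variables (A : nat -> banachAlgType R[i]) (U : set_system nat).
Hypothesis UU : UltraFilter U.

(* The ideal c_U. *)
Definition null_seq (a : linfty A) := rnorm (a n) @[n --> U] --> (0 : R).

Lemma null_seqP (a : linfty A) :
  null_seq a <-> forall e : R, 0 < e -> \forall n \near U, rnorm (a n) < e.
Proof.
split=> [/cvgrPdist_lt aU e /aU|aU].
  by apply: filterS => n; rewrite sub0r normrN ger0_norm// rnorm_ge0.
apply/cvgrPdist_lt => e /aU.
by apply: filterS => n; rewrite sub0r normrN ger0_norm// rnorm_ge0.
Qed.

Fact null_seq0 : null_seq 0.
Proof.
apply/null_seqP => e e0; apply: filterE => n.
by rewrite /rnorm /= normr0.
Qed.
Fact null_seqD a b : null_seq a -> null_seq b -> null_seq (a + b).
Proof.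
move=> /null_seqP aU /null_seqP bU; apply/null_seqP => e e0.
have e2 : 0 < e / 2 by rewrite divr_gt0.
apply: filterS2 (aU _ e2) (bU _ e2) => n ae be.
by rewrite [ltRHS]splitr; apply: le_lt_trans (rnormD _ _) _; exact: ltrD.
Qed.
Fact null_seqZ (k : R[i]) a : null_seq a -> null_seq (k *: a).
Proof.
move=> /null_seqP aU; apply/null_seqP => e e0.
have k0 : 0 < rnorm k + 1 by rewrite ltr_wpDl// rnorm_ge0.
apply: filterS (aU _ (divr_gt0 e0 k0)) => n.
rewrite ltr_pdivlMr// => /(le_lt_trans _); apply.
rewrite -(@lecR R) -rnormE rmorphM/= -rnormE normrZ mulrC ler_wpM2l//.
by rewrite rnormE lecR lerDl.
Qed.
Fact null_seq_mull a b : null_seq b -> null_seq (a ** b).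
Proof.
move=> /null_seqP bU; apply/null_seqP => e e0.
have a0 : 0 < rnorm a + 1 by rewrite ltr_wpDl// rnorm_ge0.
apply: filterS (bU _ (divr_gt0 e0 a0)) => n.
rewrite ltr_pdivlMr// => /(le_lt_trans _); apply.
apply: le_trans (rnormM _ _) _; rewrite mulrC ler_wpM2l ?rnorm_ge0//.
by apply: ler_wpDr => //; exact: rnorm_linfty.
Qed.
Fact null_seq_mulr a b : null_seq a -> null_seq (a ** b).
Proof.
move=> /null_seqP aU; apply/null_seqP => e e0.
have b0 : 0 < rnorm b + 1 by rewrite ltr_wpDl// rnorm_ge0.
apply: filterS (aU _ (divr_gt0 e0 b0)) => n.
rewrite ltr_pdivlMr// => /(le_lt_trans _); apply.
apply: le_trans (rnormM _ _) _; rewrite ler_wpM2l ?rnorm_ge0//.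
by apply: ler_wpDr => //; exact: rnorm_linfty.
Qed.
Fact null_seq_closed : closed [set a | null_seq a].
Proof.
move=> a clNa; apply/null_seqP => e e0; have e2 : 0 < e / 2 by rewrite divr_gt0.
have e2C : 0 < (e / 2)%:C by rewrite (_ : 0 = (0 : R)%:C)// ltcR.
have [b [/= /null_seqP bU]] := clNa _ (nbhsx_ballx a _ e2C).
rewrite -ball_normE/= rnormE ltcR => ab.
apply: filterS (bU _ e2) => n be; rewrite -(subrK (b n) (a n)) [ltRHS]splitr.
apply: le_lt_trans (rnormD _ _) _; apply: ltrD => //.
by apply: le_lt_trans ab; exact: (rnorm_linfty (a - b)).
Qed.

Definition null_ideal : closed_ideal (linfty A) :=
  ClosedIdeal null_seq0 null_seqD null_seqZ null_seq_mull null_seq_mulr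
    null_seq_closed.

Definition ultraproduct : banachAlgType R[i] := bquot null_ideal.

Lemma ultraproduct_norm (a : linfty A) :
  rnorm (a n) @[n --> U] --> rnorm (bproj null_ideal a).
Proof.
set L := rnorm _; apply/cvgrPdist_lt => e e0.
have e2 : 0 < e / 2 by rewrite divr_gt0.
have lt_Le : \forall n \near U, rnorm (a n) < L + e.
  have e2C : 0 < (e / 2)%:C by rewrite (_ : 0 = (0 : R)%:C)// ltcR.
  have [b ba be] := bquot_norm_adherent (bproj null_ideal a) e2C.
  have /bproj_eqP/null_seqP/(_ _ e2) := esym ba.
  apply: filterS => n ab.
  rewrite (_ : a n = b n + (a n - b n)); last by rewrite addrC subrK.
  rewrite [ltRHS](_ : _ = L + e / 2 + e / 2); last by rewrite -addrA -splitr.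
  apply: le_lt_trans (rnormD _ _) _; apply: ltrD => //.
  apply: le_lt_trans (rnorm_linfty b n) _.
  by rewrite -(@ltcR R) -rnormE rmorphD/= -rnormE.
have gt_Le : \forall n \near U, L - e < rnorm (a n).
  pose V := [set n | L - e < rnorm (a n)].
  have [//|VU] : U V \/ U (~` V) by exact: in_ultra_setVsetC.
  have [m /negP] := filter_ex VU; rewrite -leNgt => Lem.
  have Le0 : 0 <= L - e by apply: le_trans Lem; exact: rnorm_ge0.
  pose b n := if L - e < rnorm (a n) then 0 else a n.
  have b_le n : `|b n| <= (L - e)%:C.
    rewrite /b; case: ltP => [_|]; last by rewrite rnormE lecR.
    by rewrite normr0 (_ : 0 = (0 : R)%:C)// lecR.
  pose c := Linfty (ex_intro _ _ b_le).
  have ca : bproj null_ideal c = bproj null_ideal a.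
    apply/bproj_eqP/null_seqP => d d0; apply: filterS VU => n /negP nV.
    by rewrite /= /b (negPf nV) /rnorm subrr normr0.
  have : rnorm (bproj null_ideal c) <= L - e.
    rewrite -(@lecR R) -rnormE.
    have /le_trans : `|bproj null_ideal c| <= `|c| by exact: bquot_norm_le.
    by apply; exact: linfty_norm_le.
  by rewrite ca lerBrDr gerDl leNgt e0.
apply: filterS2 lt_Le gt_Le => n ltLe gtLe.
by rewrite distrC ltr_distl gtLe ltLe.
Qed.

End ultraproduct.

(* Main.v *)
Require Import Defs.
From mathcomp Require Import all_boot all_order all_algebra.
From mathcomp Require Import all_classical all_reals all_analysis.
From mathcomp Require Import complex.
From mathcomp Require Import ring.
Import Order.TTheory GRing.Theory Num.Theory.
Import numFieldNormedType.Exports.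
Local Open Scope classical_set_scope.
Local Open Scope complex_scope.
Local Open Scope ring_scope.

(* Let [e] represent an identity of the ultraproduct. For U-almost all n,
   multiplication by [e n] on either side is within 1/2 of the identity operator
   of [A n]: otherwise vectors violating this, chosen in each coordinate and
   normalised, would form a bounded sequence contradicting the choice of [e].
   By the Neumann series both multiplications are then bijective, so [A n] is
   unital: solving [e ** u = e] and cancelling [e] shows that [u] is a left
   identity, and symmetrically there is a right one. Conversely, identities of
   norm 1 form a bounded sequence. *)

(* Neumann series: the partial sums of [\sum_i (id - f)^i y] converge to a
   preimage of [y]. *)
Lemma near_id_surjective {R : realType} {V : completeNormedModType R[i]}
    (f : V -> V) :
  {morph f : x y / x - y} -> (forall x, `|f x - x| <= 2^-1 * `|x|) ->
  forall y, exists x, f x = y.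
Proof.
move=> fB f_id y; pose h : R[i] := 2^-1.
have h_gt0 k : 0 < h ^+ k by rewrite exprn_gt0// invr_gt0.
have hS k : h ^+ k = h ^+ k.+1 *+ 2.
  by rewrite exprSr -mulr_natr -mulrA /h mulVf ?mulr1// pnatr_eq0.
(* Each step adds the current residual [y - f z]. With [d] the old residual, the new one is
   [d - f d], which has at most half its norm. *)
pose x k := iter k (fun z => z + (y - f z)) 0.
have f0 : f 0 = 0 by have := fB 0 0; rewrite !subrr.
have d_le k : `|y - f (x k)| <= h ^+ k * `|y|.
  elim: k => [|k IHk]; first by rewrite /= f0 subr0 expr0 mul1r.
  set d := y - f (x k) in IHk *.
  have -> : y - f (x k.+1) = - (f d - d).
    have -> : x k.+1 = x k - (0 - d) by rewrite sub0r opprK.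
    by rewrite fB (fB 0) f0 sub0r opprK opprD addrA -/d opprB addrC.
  rewrite normrN; apply: le_trans (f_id d) _.
  by rewrite exprS -mulrA ler_wpM2l// invr_ge0.
(* The factor is the geometric sum of [h ^+ i] over [k <= i < k + m]. *)
have x_dist k m : `|x k - x (k + m)%N| <= (h ^+ k - h ^+ (k + m)) *+ 2 * `|y|.
  elim: m => [|m IHm]; first by rewrite addn0 !subrr normr0 mul0rn mul0r.
  rewrite addnS [x (_.+1)]/= opprD addrA; apply: le_trans (ler_normB _ _) _.
  apply: le_trans (lerD IHm (d_le _)) _.
  rewrite (hS (k + m)%N); set u := h ^+ k; set v := h ^+ _.
  by rewrite le_eqVlt; apply/orP; left; apply/eqP; ring.
(* The [+ 1] keeps this divisor positive when [y = 0]. *)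
have y1 : 0 < 2 * (`|y| + 1) by rewrite mulr_gt0// ltr_wpDl.
have x_cvg : cvg (x @ \oo).
  apply: cauchy_cvg; apply/cauchy_exP => e e0.
  have [k ke] := half_expr_lt (divr_gt0 e0 y1).
  exists (x k); exists k => // n /= /subnKC <-; rewrite -ball_normE/=.
  apply: le_lt_trans (x_dist _ _) _; move: ke; rewrite ltr_pdivlMr//.
  apply: le_lt_trans; rewrite -[_ *+ 2]mulr_natr -mulrA.
  apply: ler_pM => //.
  - have h_ge0 : 0 <= h by rewrite invr_ge0.
    have h_le1 : h <= 1 by rewrite invf_le1 ?ler1n.
    by rewrite subr_ge0 exprD ler_piMr ?exprn_ile1 ?(ltW (h_gt0 k))//.
  - by rewrite gerBl ltW.
  - by rewrite ler_wpM2l// lerDl.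
set l := lim (x @ \oo) in x_cvg.
exists l; apply/eqP; rewrite eq_sym -subr_eq0 -normr_le0.
apply/ler_addgt0Pr => e e0; rewrite add0r.
have e4 : 0 < e / 4%:R by rewrite divr_gt0.
have /cvgrPdist_le/(_ _ e4) xl := x_cvg.
have [N _ {}xl] := xl.
have xN := xl N (leqnn N); have xN1 := xl N.+1 (leqnSn N).
(* As [x N.+1 - x N] is the residual at [x N], the error at the limit is made of small terms; [f_id]
   bounds the last one in place of continuity. *)
have -> : y - f l = (l - x N) - (l - x N.+1) - f (l - x N).
  rewrite fB [- (l - _)]opprB (addrC (l - _)) subrKA [x N.+1]/= (addrAC (x N)) subrr.
  by rewrite add0r opprB subrKA.
have fl : `|f (l - x N)| <= e / 4%:R + e / 4%:R.
  rewrite -[f _](subrK (l - x N)); apply: le_trans (ler_normD _ _) _.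
  apply: lerD (xN); apply: le_trans (f_id _) _; apply: le_trans (xN).
  by rewrite ler_piMl// invf_le1 ?ler1n.
apply: le_trans (ler_normB _ _) _.
apply: le_trans (lerD (ler_normB _ _) fl) _.
apply: le_trans (lerD (lerD xN xN1) (lexx _)) _.
by rewrite le_eqVlt; apply/orP; left; apply/eqP; field.
Qed.

(** If [f x = f y], then [x - y] has norm at most half its own, hence is zero. *)
Lemma near_id_injective {K : numFieldType} {V : normedModType K} (f : V -> V) :
  {morph f : x y / x - y} -> (forall x, `|f x - x| <= 2^-1 * `|x|) ->
  injective f.
Proof.
move=> fB f_id x y /eqP; rewrite -subr_eq0 -fB => /eqP fxy.
apply/eqP; rewrite -subr_eq0 -normr_le0; have := f_id (x - y).
rewrite fxy sub0r normrN -subr_le0.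
rewrite -[X in X - _]mul1r -mulrBl [X in X * _](_ : _ = 2^-1); last by field.
by rewrite pmulr_rle0// invr_gt0.
Qed.

Lemma unital_near_identity {R : realType} {B : banachAlgType R[i]} (e : B) :
  (forall a, `|e ** a - a| <= 2^-1 * `|a|) ->
  (forall a, `|a ** e - a| <= 2^-1 * `|a|) -> unital B.
Proof.
move=> eL eR.
have LB : {morph bmul e : x y / x - y} by move=> x y; rewrite bmulBr.
have RB : {morph bmul^~ e : x y / x - y} by move=> x y; rewrite bmulBl.
have [u eu] := near_id_surjective _ LB eL e.
have [v ve] := near_id_surjective _ RB eR e.
have uL a : u ** a = a by apply: (near_id_injective _ LB eL); rewrite bmulA eu.
have vR a : a ** v = a by apply: (near_id_injective _ RB eR); rewrite -bmulA ve.
(* The one-sided identities agree: [u = u ** v = v]. *)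
by exists u => a; split=> //; rewrite -[u]vR uL vR.
Qed.

(** Otherwise the indices with a counterexample form a member of [U], and a choice of
    counterexamples, completed by [x0] elsewhere, violates the hypothesis. *)
Lemma ultra_near_forall (T : nat -> Type) (P : forall n, T n -> Prop)
    (U : set_system nat) : UltraFilter U ->
  (forall n, T n) -> (forall x : forall n, T n, \forall n \near U, P n (x n)) ->
  \forall n \near U, forall x, P n x.
Proof.
move=> UU x0 Px; have [//|VU] := in_ultra_setVsetC [set n | forall x, P n x] UU.
have ex n : exists x, P n x -> forall z, P n z.
  have [/existsNP[x nPx]|nex] := pselect (~ forall z, P n z).
    by exists x.
  by exists (x0 n) => _; exact: contrapT.
have [n [+ nV]] := filter_ex (filterI (Px (fun n => sval (cid (ex n)))) VU).
by move/(svalP (cid (ex n))).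
Qed.

(* The hypothesis is applied to the normalised sequence [x n / |x n|], which is
   bounded whatever [x] is. *)
Lemma null_operator_near {R : realType} (A : nat -> banachAlgType R[i])
    (U : set_system nat) (UU : UltraFilter U) (T : forall n, A n -> A n) :
  (forall n k x, T n (k *: x) = k *: T n x) ->
  (forall a : linfty A, rnorm (T n (a n)) @[n --> U] --> (0 : R)) ->
  forall e : R, 0 < e ->
  \forall n \near U, forall x, `|T n x| <= e%:C * `|x|.
Proof.
move=> TZ Tnull e e0; apply: ultra_near_forall => [n|x]; first exact: 0.
(* Where [x n = 0], the inverse of the norm is 0 and the normalised vector is 0. *)
have a_le n : `| `|x n|^-1 *: x n| <= 1.
  rewrite normrZ normfV normr_id; have [->|x0] := eqVneq (x n) 0.
    by rewrite normr0 mulr0.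
  by rewrite mulVf// normr_eq0.
have /cvgrPdist_le/(_ e e0) := Tnull (Linfty (ex_intro _ _ a_le)).
apply: filterS => n /=; rewrite sub0r normrN ger0_norm ?rnorm_ge0//.
have [->|x0] := eqVneq (x n) 0.
  by have := TZ n 0 0; rewrite !scale0r => ->; rewrite !normr0 mulr0.
rewrite -lecR -rnormE TZ normrZ normfV normr_id.
by rewrite ler_pdivrMl ?normr_gt0// mulrC.
Qed.

Theorem proposition2p1 (R : realType) (A : nat -> banachAlgType R[i])
    (U : set_system nat) (UU : UltraFilter U)
    (U_nonprincipal : forall n, U <> principal_filter n)
    (norm_identity : forall n (e : A n), is_identity e -> `|e| = 1)
    (norm_identity_ultraproduct :
      forall e : ultraproduct A UU, is_identity e -> `|e| = 1) :
  unital (ultraproduct A UU) <->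
  exists2 V : set nat, U V & forall n, V n -> unital (A n).
Proof.
split=> [[q]|[V VU uV]].
  have [e ->] := bproj_surj q => e1.
  have h0 : 0 < 2^-1 :> R by rewrite invr_gt0.
  have hC : (2^-1)%:C = 2^-1 :> R[i] by rewrite fmorphV rmorph_nat.
  have eL : \forall n \near U, forall x : A n, `|e n ** x - x| <= 2^-1 * `|x|.
    rewrite -hC; apply: (null_operator_near A U UU (fun n x => e n ** x - x)) h0.
      by move=> n k x; rewrite -bscalerAr scalerBr.
    (* Equality of the two classes says exactly that [e ** a - a] lies in the ideal. *)
    move=> a; have /bproj_eqP : bproj (null_ideal A UU) (e ** a) = bproj _ a.
      by rewrite bprojM (e1 _).1.
    exact.
  have eR : \forall n \near U, forall x : A n, `|x ** e n - x| <= 2^-1 * `|x|.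
    rewrite -hC; apply: (null_operator_near A U UU (fun n x => x ** e n - x)) h0.
      by move=> n k x; rewrite -bscalerAl scalerBr.
    move=> a; have /bproj_eqP : bproj (null_ideal A UU) (a ** e) = bproj _ a.
      by rewrite bprojM (e1 _).2.
    exact.
  eexists; first exact: (filterI eL eR).
  by move=> n [nL nR]; exact: unital_near_identity _ nL nR.
(* The value 0 off [V] keeps the sequence bounded by 1 and does not affect its class. *)
have ex n : exists e : A n, `|e| <= 1 /\ (V n -> is_identity e).
  have [/uV[e e1]|nV] := pselect (V n).
    by exists e; split=> //; rewrite (norm_identity _ _ e1).
  by exists 0; rewrite normr0.
pose eP n := svalP (cid (ex n)).
have e_le n : `|sval (cid (ex n))| <= 1 by exact: (eP n).1.
pose e_ := Linfty (ex_intro _ _ e_le).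
exists (bproj (null_ideal A UU) e_) => p; have [a ->] := bproj_surj p.
have near0 (b : linfty A) : (forall n, V n -> b n = 0) -> null_seq U b.
  move=> b0; apply/null_seqP => d d0; apply: filterS VU => n /b0 ->.
  by rewrite /rnorm normr0.
rewrite -!bprojM; split; apply/bproj_eqP; apply: near0 => n Vn.
  by have [_ /(_ Vn)/(_ (a n))[+ _]] := eP n => /= ->; rewrite subrr.
by have [_ /(_ Vn)/(_ (a n))[_ +]] := eP n => /= ->; rewrite subrr.
Qed.
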